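(* Let $X$ be a finite set and let $[\delta,\pi]$ be a cloud on $X$. Then the uncertainty modeled by $[\delta,\pi]$ is representable by the pair of possibility distributions $1-\delta$ and $\pi$, and $$\mathcal{P}_{[\delta,\pi]}=\mathcal{P}_{\pi}\cap\mathcal{P}_{1-\delta}.$$
   Context: $X$ is a finite set and $\mathbb{P}_X$ is the set of probability measures on $X$. A cloud $[\delta,\pi]$ on $X$ is a pair of mappings $\delta,\pi:X\to[0,1]$ with $\delta\le\pi$ pointwise, $\pi(x)=1$ for at least one $x\in X$, and $\delta(y)=0$ for at least one $y\in X$. Its credal set is $$\mathcal{P}_{[\delta,\pi]}=\{P\in\mathbb{P}_X \mid \forall \alpha\in[0,1],\ P(\{x\in X\mid \delta(x)\ge\alpha\})\le 1-\alpha\le P(\{x\in X\mid \pi(x)>\alpha\})\}.$$ A possibility distribution on $X$ is a mapping $\pi:X\to[0,1]$ with $\pi(x)=1$ for at least one $x$. Its credal set is $\mathcal{P}_\pi=\{P\in\mathbb{P}_X\mid \forall\alpha\in[0,1],\ 1-\alpha\le P(\{x\in X\mid\pi(x)>\alpha\})\}$. *)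

(* Defs.v *)
From HB Require Import structures.
From mathcomp Require Import all_boot all_order all_algebra.
From mathcomp Require Import all_classical all_reals all_analysis.

Set Implicit Arguments.
Unset Strict Implicit.
Unset Printing Implicit Defensive.

Import Order.TTheory GRing.Theory Num.Theory.

Local Open Scope classical_set_scope.
Local Open Scope ring_scope.

(* An alias carrying the discrete sigma-algebra, in which every subset of X is
   an event.  Measurable types are pointed, hence the pointedType; the chosen
   point plays no role, and a set carrying a cloud or a possibility distribution
   is nonempty anyway. *)
Definition discrete_space_of (X : pointedType) : Type := X.

HB.instance Definition _ (X : pointedType) := Pointed.on (discrete_space_of X).
HB.instance Definition _ (X : pointedType) :=
  @isMeasurable.Build default_measure_display (discrete_space_of X)
    discrete_measurable discrete_measurable0
    discrete_measurableC discrete_measurableU.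

Section Clouds.
Variables (R : realType) (X : pointedType).

Definition unit_valued (f : X -> R) : Prop := forall x, 0 <= f x <= 1.

Record is_cloud (delta pi : X -> R) : Prop := IsCloud {
  cloud_lower_unit : unit_valued delta;
  cloud_upper_unit : unit_valued pi;
  cloud_le : forall x, delta x <= pi x;
  cloud_upper_one : exists x, pi x = 1;
  cloud_lower_zero : exists y, delta y = 0 }.

Record is_possibility (pi : X -> R) : Prop := IsPossibility {
  possibility_unit : unit_valued pi;
  possibility_one : exists x, pi x = 1 }.

Definition cloud_credal (delta pi : X -> R) :
    set (probability (discrete_space_of X) R) :=
  [set P | forall alpha : R, 0 <= alpha <= 1 ->
    (P [set x | (alpha <= delta x)%R] <= (1 - alpha)%:E)%E /\
    ((1 - alpha)%:E <= P [set x | (alpha < pi x)%R])%E].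

Definition possibility_credal (pi : X -> R) :
    set (probability (discrete_space_of X) R) :=
  [set P | forall alpha : R, 0 <= alpha <= 1 ->
    ((1 - alpha)%:E <= P [set x | (alpha < pi x)%R])%E].

End Clouds.

(* Main.v *)
Require Import Defs.
From mathcomp Require Import all_boot all_order all_algebra.
From mathcomp Require Import all_classical all_reals all_analysis.
Import Order.TTheory GRing.Theory Num.Theory.

Local Open Scope classical_set_scope.
Local Open Scope ring_scope.

(** The upper half of the cloud condition is by definition membership in the
    credal set of [pi], so everything rests on the lower half being membership
    in the credal set of [1 - delta].  The strict [beta]-cut of [1 - delta] is
    the complement of the weak [1 - beta]-cut of [delta]; taking complements
    turns a lower bound on the probability of the former into an upper bound on
    that of the latter ([le_probability_setC]), and [beta |-> 1 - beta] permutes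
    the unit interval, so the two families of constraints are the same
    ([possibility_credal_onem]). *)

Lemma le_probability_setC d (T : measurableType d) (R : realType)
    (P : probability T R) (A : set T) (r : R) : measurable A ->
  (r%:E <= P (~` A))%E = (P A <= (1 - r)%:E)%E.
Proof.
move=> mA; rewrite probability_setC//.
rewrite -(fineK (fin_num_measure P A mA)) -EFinB !lee_fin.
by rewrite lerBrDr addrC -lerBrDr.
Qed.

Lemma onem_strict_cut (R : realType) (X : Type) (f : X -> R) (beta : R) :
  [set x | (beta < 1 - f x)%R] = ~` [set x | (1 - beta <= f x)%R].
Proof.
apply/seteqP; split => x /=; last move/negP.
  by rewrite ltrBrDl -ltrBrDr => flt; apply/negP; rewrite -ltNge.
by rewrite -ltNge ltrBrDl -ltrBrDr.
Qed.

(** Possibilistic constraints on [1 - delta] are upper bounds on the weak cuts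
    of [delta]: the [beta]-constraint of the one, complemented, is the
    [1 - beta]-constraint of the other. *)
Lemma possibility_credal_onem (R : realType) (X : pointedType)
    (delta : X -> R) (P : probability (discrete_space_of X) R) :
  possibility_credal (fun x => 1 - delta x) P <->
  (forall alpha : R, 0 <= alpha <= 1 ->
    (P [set x | (alpha <= delta x)%R] <= (1 - alpha)%:E)%E).
Proof.
have cutE beta : ((1 - beta)%:E <= P [set x | (beta < 1 - delta x)%R])%E =
    (P [set x | (1 - beta <= delta x)%R] <= (1 - (1 - beta))%:E)%E.
  by rewrite onem_strict_cut le_probability_setC.
have onem01 (r : R) : 0 <= r <= 1 -> 0 <= 1 - r <= 1.
  by move=> /andP[r0 r1]; rewrite subr_ge0 r1 gerBl.
split=> credal r /onem01 r01; last by rewrite cutE; exact: credal.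
by have := credal _ r01; rewrite cutE !subKr.
Qed.

Lemma is_possibility_onem (R : realType) (X : pointedType) (delta : X -> R) :
  unit_valued delta -> (exists y, delta y = 0) ->
  is_possibility (fun x => 1 - delta x).
Proof.
move=> delta01 [y deltay0]; split; last by exists y; rewrite deltay0 subr0.
by move=> x; have /andP[d0 d1] := delta01 x; rewrite subr_ge0 d1 gerBl.
Qed.

Theorem proposition1 (R : realType) (X : pointedType)
    (finX : finite_set [set: X]) (delta pi : X -> R)
    (cloud_delta_pi : is_cloud delta pi) :
  [/\ is_possibility (fun x => 1 - delta x),
      is_possibility pi &
      cloud_credal delta pi =
        possibility_credal pi `&` possibility_credal (fun x => 1 - delta x)].
Proof.
case: cloud_delta_pi => delta01 pi01 _ pi1 delta0.
split; [exact: is_possibility_onem | by [] |].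
apply/seteqP; split => P.
  move=> credal; split; last apply/possibility_credal_onem.
    by move=> alpha /credal[].
  by move=> alpha /credal[].
by move=> [Ppi /possibility_credal_onem Pdelta] alpha a01; split; auto.
Qed.
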